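(* Let $F$ be a field of characteristic zero, $f$ an anti-involution of $F^\times$, and $\Phi_f=(G,F^\times,\varphi,f)$ a skew gain graph whose underlying simple graph $G$ has order $n$. Write $\Psi(\Phi_f,x)=\det(xI-A(\Phi_f))=\sum_{i=0}^{n}a_i(\Phi_f)x^{n-i}$. Then for each $i$, $$a_i(\Phi_f)=\sum_{L\in\mathfrak{L}_i}(-1)^{K(L)}\Big(\prod_{K_2\text{-components } uv \text{ of } L} g(\varphi(\overrightarrow{uv}))\Big)\prod_{\text{cycle components } C \text{ of } L}\big(\varphi(C)+f(\varphi(C))\big),$$ where $\mathfrak{L}_i$ is the set of elementary subgraphs of $G$ of order $i$ and $K(L)$ is the number of components of $L$ (with the conventions $a_0=1$, $a_1=0$).
   Context: An anti-involution of $F^\times$ is a map $f:F^\times\to F^\times$ with $f(f(x))=x$ and $f(xy)=f(y)f(x)$ for all $x,y$. A skew gain graph $\Phi_f=(G,F^\times,\varphi,f)$ consists of a simple graph $G$ with vertices $v_1,\dots,v_n$ and a function $\varphi$ assigning to each oriented edge $\overrightarrow{uv}$ (both orientations of every edge $uv$ are considered) an element of $F^\times$ such that $\varphi(\overrightarrow{vu})=f(\varphi(\overrightarrow{uv}))$. Its adjacency matrix $A(\Phi_f)=(a_{ij})$ is the $n\times n$ matrix with $a_{ij}=\varphi(\overrightarrow{v_iv_j})$ if $v_i\sim v_j$ and $a_{ij}=0$ otherwise. Define $g:F^\times\to F^\times$ by $g(x)=xf(x)$; note $g(\varphi(\overrightarrow{uv}))=g(\varphi(\overrightarrow{vu}))$.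 For a cycle $C:v_0v_1\cdots v_kv_0$ in $G$, its skew gain is $\varphi(C)=\varphi(\overrightarrow{v_0v_1})\varphi(\overrightarrow{v_1v_2})\cdots\varphi(\overrightarrow{v_kv_0})$. An elementary subgraph of $G$ is a subgraph each of whose components is either $K_2$ or a cycle; its order is its number of vertices. *)

(* Defs.v *)
From HB Require Import structures.
From mathcomp Require Import all_boot all_order all_algebra.

Set Implicit Arguments.
Unset Strict Implicit.
Unset Printing Implicit Defensive.

Import GRing.Theory.
Local Open Scope ring_scope.

(* F^* is the set GRing.unit of nonzero elements; a map F^* -> F^* is a
   function on F preserving this set, its value at 0 being irrelevant. *)
Definition anti_involution (F : fieldType) (f : F -> F) : Prop :=
  [/\ {in GRing.unit, forall x, f x \is a GRing.unit},
      {in GRing.unit, forall x, f (f x) = x} &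
      {in GRing.unit &, forall x y, f (x * y) = f y * f x}].

(* [gain u v] is the gain of the oriented edge from u to v; its value is
   irrelevant when u and v are not adjacent. *)
Record skew_gain_graph (F : fieldType) (f : F -> F) (n : nat) :=
  SkewGainGraph {
    adj : rel 'I_n;
    gain : 'I_n -> 'I_n -> F;
    adj_sym : symmetric adj;
    adj_irr : irreflexive adj;
    gain_unit : forall u v, adj u v -> gain u v \is a GRing.unit;
    gain_rev : forall u v, adj u v -> gain v u = f (gain u v)
  }.

Definition adjacency_matrix (F : fieldType) (f : F -> F) (n : nat)
    (Phi : skew_gain_graph f n) : 'M[F]_n :=
  \matrix_(i, j) (if adj Phi i j then gain Phi i j else 0).

Section Subgraphs.

Variable n : nat.

(* A graph on part of 'I_n: a vertex set and a set of edges, an edge being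
   the set of its two ends. *)
Definition pregraph := ({set 'I_n} * {set {set 'I_n}})%type.

Definition verts (L : pregraph) : {set 'I_n} := L.1.
Definition edges (L : pregraph) : {set {set 'I_n}} := L.2.

Definition is_subgraph (e : rel 'I_n) (L : pregraph) : bool :=
  [forall x in edges L, (x \subset verts L) &&
     [exists u, exists v, e u v && (x == [set u; v])]].

Definition edge_rel (L : pregraph) : rel 'I_n :=
  [rel u v | [set u; v] \in edges L].

Definition components (L : pregraph) : {set pregraph} :=
  [set (A, [set x in edges L | x \subset A])
     | A : {set 'I_n} in equivalence_partition (connect (edge_rel L)) (verts L)].

Definition K2 (u v : 'I_n) : pregraph := ([set u; v], [set [set u; v]]).

Definition is_K2 (C : pregraph) : bool :=
  [exists u, exists v, (u != v) && (C == K2 u v)].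

(* C is the cycle v_0 v_1 ... v_k v_0, where s = [:: v_0; ...; v_k], k >= 2. *)
Definition traverses (s : seq 'I_n) (C : pregraph) : bool :=
  [&& (2 < size s)%N, uniq s, verts C == [set x in s] &
      edges C == [set [set x; next s x] | x in s]].

Definition is_cycle (C : pregraph) : bool :=
  [exists s : #|verts C|.-tuple 'I_n, traverses s C].

Definition elementary (e : rel 'I_n) (L : pregraph) : bool :=
  is_subgraph e L && [forall C in components L, is_K2 C || is_cycle C].

Definition elementary_subgraphs (e : rel 'I_n) (i : nat) : {set pregraph} :=
  [set L | elementary e L && (#|verts L| == i)].

End Subgraphs.

Section SkewGains.

Variables (F : fieldType) (f : F -> F) (n : nat) (Phi : skew_gain_graph f n).

Definition norm_map (x : F) : F := x * f x.

Definition closed_walk_gain (s : seq 'I_n) : F :=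
  \prod_(x <- s) gain Phi x (next s x).

(* Another traversal of the cycle C either has the same gain as the one
   picked, or, for the opposite direction, its image under f; as f is
   involutive, the sum below does not depend on the traversal. *)
Definition cycle_weight (C : pregraph n) : F :=
  if [pick s : #|verts C|.-tuple 'I_n | traverses s C] is Some s
  then closed_walk_gain s + f (closed_walk_gain s) else 0.

(* Each K2-component is listed once, with its ends in increasing order;
   norm_map takes the same value on both orientations of an edge. *)
Definition elementary_weight (L : pregraph n) : F :=
  (-1) ^+ #|components L|
  * (\prod_(p : 'I_n * 'I_n | (p.1 < p.2)%N && (K2 p.1 p.2 \in components L))
       norm_map (gain Phi p.1 p.2))
  * \prod_(C in components L | is_cycle C) cycle_weight C.

End SkewGains.

(* Main.v *)
(* Expand det (xI - A) over permutations: as A has zero diagonal, a_i is the sum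
   over the permutations s moving exactly i points of (-1)^(number of
   nontrivial orbits of s) times the product of the entries a_(x, s x) over the
   moved points. Group these permutations by the graph whose edges are the
   pairs {x, s x}; the graphs so obtained from the nonzero terms are the
   elementary subgraphs, with the nontrivial orbits as components. The
   permutations with a given graph L arise from one of them by reversing it on a
   set of cycle components of L, so the sum over this fibre factors into a + b
   for each cycle component, a and b being the gains of its two traversals,
   with b = f a. *)

Require Import Defs.
From HB Require Import structures.
From mathcomp Require Import all_boot all_order all_algebra.
From mathcomp Require Import fingroup perm.
Set Implicit Arguments.
Unset Strict Implicit.
Unset Printing Implicit Defensive.
Import GRing.Theory.
Local Open Scope ring_scope.

(** * Unordered pairs, products of sums, successors in a list *)

Lemma set2_inj (T : finType) (a b c d : T) :
  [set a; b] = [set c; d] -> (a = c /\ b = d) \/ (a = d /\ b = c).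
Proof.
move=> eq_s.
have: a \in [set c; d] by rewrite -eq_s set21.
have: b \in [set c; d] by rewrite -eq_s set22.
have: c \in [set a; b] by rewrite eq_s set21.
have: d \in [set a; b] by rewrite eq_s set22.
rewrite !inE; do 4![case/orP=> /eqP ?]; subst; by [left | right].
Qed.

(** [bigA_distr] runs over all subsets of the index type. Extending [F] by 0 and [G] by 1 outside
    [D] kills the subsets not contained in [D] and makes the extra factors of the others trivial. *)
Lemma prodrD_subsets (R : comPzSemiRingType) (I : finType) (D : {set I})
    (F G : I -> R) :
  \prod_(i in D) (F i + G i) =
    \sum_(J : {set I} | J \subset D)
      \prod_(i in D) (if i \in J then F i else G i).
Proof.
pose F' i := if i \in D then F i else 0.
pose G' i := if i \in D then G i else 1.
have -> : \prod_(i in D) (F i + G i) = \prod_i (F' i + G' i).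
  rewrite [RHS](bigID [in D]) /= [X in _ * X]big1 ?mulr1 => [|i /negPf Di].
    by apply: eq_bigr => i Di; rewrite /F' /G' Di.
  by rewrite /F' /G' Di add0r.
rewrite bigA_distr (bigID [pred J : {set I} | J \subset D]) /=.
rewrite [X in _ + X]big1 ?addr0 => [|J /subsetPn[i Ji Di]]; last first.
  by rewrite (bigD1 i) //= Ji /F' (negPf Di) mul0r.
apply: eq_big => [J | J /subsetP sJD] //.
rewrite [LHS](bigID [in D]) /= [X in _ * X]big1 ?mulr1 => [|i Di].
  by apply: eq_bigr => i Di; rewrite /F' /G' Di.
by rewrite /G' (negPf Di) ifN //; apply: contra Di => /sJD.
Qed.

Lemma next_neq (T : eqType) (s : seq T) (x : T) :
  uniq s -> (1 < size s)%N -> x \in s -> next s x != x.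
Proof.
move=> Us gt1 /rot_to[i p Dp]; rewrite -(next_rot i) // Dp.
have := Us; rewrite -(rot_uniq i) Dp.
have := gt1; rewrite -(size_rot i) Dp.
case: p {Dp} => [|y p] //= _; rewrite inE negb_or eqxx eq_sym.
by case/andP=> /andP[].
Qed.

(** * Moved points and nontrivial orbits of a permutation *)

Section MovedPoints.

Variable T : finType.
Implicit Types (s t : {perm T}) (x y : T).

Definition moved s : {set T} := [set x | s x != x].

Definition cycle_supports s : {set {set T}} := porbit s @: moved s.

Definition perm_edges s : {set {set T}} := [set [set x; s x] | x in moved s].

Lemma movedP s x : x \notin moved s -> s x = x.
Proof. by rewrite inE negbK => /eqP. Qed.

Lemma mem_movedE s x : (s x \in moved s) = (x \in moved s).
Proof. by rewrite !inE (inj_eq perm_inj). Qed.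

Lemma porbit_perm1 s x : porbit s (s x) = porbit s x.
Proof. by have := porbit_perm s 1 x; rewrite expg1. Qed.

Lemma porbit_moved s x y :
  y \in porbit s x -> (y \in moved s) = (x \in moved s).
Proof.
case/porbitP=> i ->; elim: i => [|i IHi]; first by rewrite expg0 perm1.
by rewrite expgSr permM mem_movedE.
Qed.

Lemma porbit_fixed s x : x \notin moved s -> porbit s x = [set x].
Proof.
move=> /movedP sx; apply/setP=> y; rewrite inE;
  apply/porbitP/eqP => [[i ->]|->].
  by elim: i => [|i IHi]; rewrite ?expg0 ?perm1 // expgSr permM IHi.
by exists 0%N; rewrite expg0 perm1.
Qed.

Lemma card_porbit_moved s x : x \in moved s -> (1 < #|porbit s x|)%N.
Proof.
rewrite inE => sx; have /subset_leq_card : [set x; s x] \subset porbit s x.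
  by rewrite subUset !sub1set porbit_id -porbit_perm1 porbit_id.
by rewrite cards2 eq_sym sx.
Qed.

Lemma porbit_sub_moved s x : x \in moved s -> porbit s x \subset moved s.
Proof. by move=> mx; apply/subsetP=> y /porbit_moved->. Qed.

Lemma partition_cycle_supports s : partition (cycle_supports s) (moved s).
Proof.
apply/and3P; split.
- rewrite eqEsubset; apply/andP; split.
    by apply/bigcupsP=> _ /imsetP[x mx ->]; apply: porbit_sub_moved.
  apply/subsetP=> x mx; apply/bigcupP; exists (porbit s x).
    exact: imset_f.
  exact: porbit_id.
- apply/trivIsetP=> _ _ /imsetP[x _ ->] /imsetP[y _ ->].
  apply: contraR => /pred0Pn[z /andP[/= zx zy]].
  by rewrite -!eq_porbit_mem in zx zy; rewrite -(eqP zx).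
- apply/negP=> /imsetP[x _ /setP/(_ x)].
  by rewrite porbit_id inE.
Qed.

Lemma cycle_supports_porbit s A x :
  A \in cycle_supports s -> x \in A -> porbit s x = A.
Proof. by case/imsetP=> y _ ->; rewrite -eq_porbit_mem => /eqP. Qed.

Lemma cycle_supports_moved s A x :
  A \in cycle_supports s -> x \in A -> x \in moved s.
Proof. by case/imsetP=> y my -> /porbit_moved->. Qed.

Lemma cycle_supports_succ s A x :
  A \in cycle_supports s -> (s x \in A) = (x \in A).
Proof. by case/imsetP=> y _ ->; rewrite -!eq_porbit_mem porbit_perm1. Qed.

Lemma cycle_supports_card s A : A \in cycle_supports s -> (1 < #|A|)%N.
Proof. by case/imsetP=> x mx ->; apply: card_porbit_moved. Qed.

(* The sign formula with the fixed points, which are orbits of their own,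
   left out of the orbit count. *)
Lemma sign_moved (R : pzRingType) s :
  (-1) ^+ s * (-1) ^+ #|moved s| = (-1) ^+ #|cycle_supports s| :> R.
Proof.
have -> : (-1) ^+ s = (-1) ^+ (#|T| + #|porbits s|) :> R.
  by rewrite -[RHS]signr_odd oddD.
have -> : #|porbits s| = (#|cycle_supports s| + #|~: moved s|)%N.
  have -> : porbits s = cycle_supports s :|: set1 @: ~: moved s.
    apply/setP=> A; rewrite inE; apply/imsetP/orP=> [[x _ ->]|].
      have [mx|mx] := boolP (x \in moved s); [left | right].
        exact: imset_f.
      by rewrite porbit_fixed // imset_f // inE.
    case=> /imsetP[x mx ->]; exists x => //.
    by rewrite porbit_fixed // -in_setC.
  rewrite cardsU disjoint_setI0 ?cards0 ?subn0 ?(card_imset _ set1_inj) //.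
  apply/pred0P=> A /=; apply/negP=> /andP[/imsetP[x mx ->] /imsetP[y _ defA]].
  by have := card_porbit_moved mx; rewrite defA cards1.
rewrite -exprD -(cardsC (moved s)) -signr_odd !oddD.
rewrite -[RHS]signr_odd.
by case: (odd #|moved s|); case: (odd #|~: _|); case: (odd #|cycle_supports s|).
Qed.

(** * Permutations with the same edges *)

Lemma perm_edges_succ s x : x \in moved s -> [set x; s x] \in perm_edges s.
Proof. by move=> mx; apply/imsetP; exists x. Qed.

Lemma mem_perm_edges s x y :
  ([set x; y] \in perm_edges s) = (x \in moved s) && ((y == s x) || (x == s y)).
Proof.
apply/imsetP/andP=> [[z mz /set2_inj[[-> ->]|[-> ->]]]|[mx /orP[]/eqP Dy]].
- by rewrite eqxx.
- by rewrite mem_movedE eqxx orbT.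
- by exists x; rewrite // Dy.
- by exists y; [rewrite -mem_movedE -Dy | rewrite -Dy setUC].
Qed.

Lemma perm_edgesV s : perm_edges s^-1 = perm_edges s.
Proof.
have sub t : perm_edges t^-1 \subset perm_edges t.
  apply/subsetP=> _ /imsetP[x mx ->];
    rewrite mem_perm_edges permKV eqxx orbT andbT.
  by move: mx; rewrite !inE; apply: contra => /eqP {1}<-; rewrite permK.
by apply/eqP; rewrite eqEsubset sub /= -{1}[s]invgK sub.
Qed.

Lemma movedV s : moved s^-1 = moved s.
Proof.
by apply/setP=> x; rewrite !inE -(inj_eq (@perm_inj _ s)) permKV eq_sym.
Qed.

(* Both neighbours of [s x] in the common cycle are known once [x] is one of
   them, so agreement of the successor maps propagates along the cycle. *)
Lemma perm_edges_step s t x :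
    perm_edges s = perm_edges t -> moved s = moved t ->
  s x = t x -> s (s x) = t (t x).
Proof.
move=> eqE eqM eqx; have [mx|mx] := boolP (x \in moved s); last first.
  by rewrite -eqx [s x]movedP // -eqx movedP.
set y := s x; rewrite -eqx -/y.
have my : y \in moved s by rewrite mem_movedE.
have : [set y; s y] \in perm_edges t by rewrite -eqE perm_edges_succ.
have : [set y; t y] \in perm_edges s by rewrite eqE perm_edges_succ // -eqM.
rewrite !mem_perm_edges -eqM my /=.
move=> /orP[/eqP->//|/eqP y1] /orP[/eqP->//|/eqP y2].
have /perm_inj <- : s x = s (t y) by [].
by apply: (@perm_inj _ t); rewrite -y2 -eqx.
Qed.

Lemma perm_edges_agree s t x :
    perm_edges s = perm_edges t -> moved s = moved t -> s x = t x ->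
  {in porbit s x, s =1 t}.
Proof.
move=> eqE eqM eqx _ /porbitP[i ->].
elim: i => [|i IHi]; first by rewrite expg0 perm1.
by rewrite expgSr permM (perm_edges_step eqE eqM IHi) IHi.
Qed.

(** The pair formed by [x] and [t x] is also an edge of [s], and the only edges of [s] at [x] lead
    to its successor and its predecessor. *)
Lemma perm_edges_dichotomy s t x :
  perm_edges s = perm_edges t -> moved s = moved t ->
    t x = s x \/ t x = (s^-1)%g x.
Proof.
move=> eqE eqM; have [mx|mx] := boolP (x \in moved s); last first.
  by left; rewrite !movedP -?eqM.
have : [set x; t x] \in perm_edges s by rewrite eqE perm_edges_succ -?eqM.
rewrite mem_perm_edges mx => /orP[]/eqP; first by left.
by move=> Dx; right; rewrite {2}Dx permK.
Qed.

(** * Reversing a permutation on a set of orbits *)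

Section Flip.

Variables (s : {perm T}) (J : {set {set T}}).

Definition flip_fun x := if porbit s x \in J then (s^-1)%g x else s x.

Lemma porbit_flip_fun x : porbit s (flip_fun x) = porbit s x.
Proof.
rewrite /flip_fun; case: ifP => _; last exact: porbit_perm1.
by rewrite -porbitV porbit_perm1 porbitV.
Qed.

(** Each point stays in its orbit, so two points with equal images share an orbit, where the map is
    [s] or its inverse throughout. *)
Lemma flip_fun_inj : injective flip_fun.
Proof.
move=> x y eq_xy; have := porbit_flip_fun x; rewrite eq_xy porbit_flip_fun.
by move: eq_xy; rewrite /flip_fun => + eqP; rewrite eqP;
  case: ifP => _ /perm_inj.
Qed.

Definition flip : {perm T} := perm flip_fun_inj.

Lemma flipE x : flip x = if porbit s x \in J then (s^-1)%g x else s x.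
Proof. by rewrite permE. Qed.

Lemma moved_flip : moved flip = moved s.
Proof.
apply/setP=> x; have := congr1 (fun A : {set T} => x \in A) (movedV s).
by rewrite !inE flipE; case: ifP.
Qed.

Lemma perm_edges_flip : perm_edges flip = perm_edges s.
Proof.
have in_s x : [set x; flip x] \in perm_edges s = (x \in moved s).
  by rewrite mem_perm_edges flipE; case: ifP; rewrite ?permKV eqxx ?orbT andbT.
apply/eqP; rewrite eqEsubset; apply/andP; split;
  apply/subsetP=> _ /imsetP[x mx ->].
  by rewrite in_s -moved_flip.
(* On a reversed orbit the edge from [x] to [s x] is produced by [s x], which is now sent to [x]. *)
rewrite mem_perm_edges moved_flip mx !flipE porbit_perm1 permK.
by case: ifP; rewrite eqxx ?orbT.
Qed.

End Flip.

(* A 2-cycle is its own inverse, so only longer cycles are worth reversing. *)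
Definition long_supports s := [set A in cycle_supports s | (2 < #|A|)%N].

(** If the successor and predecessor of [x] coincide, the orbit is exhausted by [x] and [s x], so it
    has at most two points. *)
Lemma long_supports_neq s A x :
  A \in long_supports s -> x \in A -> s x != (s^-1)%g x.
Proof.
rewrite inE => /andP[As gt2] Ax; apply: contraL gt2 => /eqP eqsx.
rewrite -(cycle_supports_porbit As Ax) -leqNgt.
apply: leq_trans (_ : #|[set x; s x]| <= 2)%N;
  last by rewrite cards2; case: eqP.
apply/subset_leq_card/subsetP=> _ /porbitP[i ->].
have ssx : s (s x) = x by rewrite eqsx permKV.
elim: i => [|i IHi]; first by rewrite expg0 perm1 set21.
rewrite expgSr permM; case/set2P: IHi => ->; rewrite ?ssx ?set21 //;
  exact: set22.
Qed.

Definition flipped s t :=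
  [set A in long_supports s | [exists x in A, t x != s x]].

(** A single disagreement between [t] and [s] on an orbit forces [t] to be the inverse of [s] there,
    by the dichotomy, and this propagates along the orbit. So each orbit is either kept or reversed
    as a whole. *)
Lemma flip_flipped s t :
  perm_edges s = perm_edges t -> moved s = moved t -> flip s (flipped s t) = t.
Proof.
move=> eqE eqM; apply/permP=> x; rewrite flipE inE.
have [mx|mx] := boolP (x \in moved s); last first.
  have tx : t x = x by rewrite movedP -?eqM.
  rewrite tx; case: ifP; rewrite ?movedP ?movedV //.
have Ax : porbit s x \in cycle_supports s by apply: imset_f.
have [/existsP[y /andP[yx neq_y]] | /existsPn eqx] :=
  boolP [exists y in porbit s x, t y != s y].
  have ts y' : y' \in porbit s x -> t y' = (s^-1)%g y'.
    have [eqy|eqy] := perm_edges_dichotomy y eqE eqM;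
      first by rewrite eqy eqxx in neq_y.
    rewrite -eq_porbit_mem in yx; rewrite -(eqP yx) -porbitV => y's.
    apply/esym/(@perm_edges_agree s^-1%g t y); rewrite ?perm_edgesV ?movedV //.
  have -> : porbit s x \in long_supports s.
    rewrite inE Ax ltn_neqAle card_porbit_moved // andbT.
    (* On an orbit of two points [s] is its own inverse, so [t] could not differ from it. *)
    apply: contraNneq neq_y => eq2; rewrite ts //.
    apply/eqP/(@perm_inj _ s); rewrite permKV.
    have := iter_porbit s y; rewrite -eq_porbit_mem in yx.
    by rewrite (eqP yx) -eq2 /= => ->.
  by rewrite ts // porbit_id.
rewrite andbF; by have := eqx x; rewrite porbit_id negbK => /eqP->.
Qed.

(** A cycle of length at least 3 differs from its reversal at every point, so the reversed long
    cycles can be read off [flip s J]. With [flip_flipped] this makes the subsets of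
    [long_supports s] parametrize the permutations with the same graph as [s]. *)
Lemma flipped_flip s J :
  (flipped s (flip s J) == J) = (J \subset long_supports s).
Proof.
apply/eqP/idP=> [<-|/subsetP sJ];
  first by apply/subsetP=> A; rewrite inE => /andP[].
apply/setP=> A; rewrite inE; have [lA|lA] := boolP (A \in _); last first.
  by apply/esym/negbTE; apply: contra lA; apply: sJ.
have cA : A \in cycle_supports s by move: lA; rewrite inE => /andP[].
rewrite /=; apply/existsP/idP=> [[x /andP[Ax]]|JA].
  by rewrite flipE (cycle_supports_porbit cA Ax); case: ifP; rewrite ?eqxx.
have [x mx defA] := imsetP cA; have Ax : x \in A by rewrite defA porbit_id.
exists x; rewrite Ax flipE (cycle_supports_porbit cA Ax) JA /= eq_sym.
exact: long_supports_neq lA Ax.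
Qed.

End MovedPoints.

(** * Components of a graph and their vertex sets *)

Section ElementarySubgraphs.

Variable n : nat.
Implicit Types (e : rel 'I_n) (s : {perm 'I_n}) (L C : pregraph n).
Implicit Types A : {set 'I_n}.

Definition supports L := equivalence_partition (connect (edge_rel L)) (verts L).

Definition component_on L A : pregraph n :=
  (A, [set x in edges L | x \subset A]).

Lemma component_on_inj L : injective (component_on L).
Proof. by move=> A B []. Qed.

Lemma card_components L : #|components L| = #|supports L|.
Proof. exact: card_imset (@component_on_inj L). Qed.

Lemma mem_components L A :
  (component_on L A \in components L) = (A \in supports L).
Proof. exact: mem_imset (@component_on_inj L). Qed.

Lemma connect_edge_sym L : connect_sym (edge_rel L).
Proof.
by apply: sym_connect_sym => u v; rewrite /edge_rel /= setUC.
Qed.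

Lemma connect_edge_equivalence L : equivalence_rel (connect (edge_rel L)).
Proof.
apply/equivalence_relP; split=> [x|x y xy]; first exact: connect0.
exact: same_connect (@connect_edge_sym L) _ _ xy.
Qed.

Lemma partition_supports L : partition (supports L) (verts L).
Proof.
apply: equivalence_partitionP => x y z _ _ _; exact: connect_edge_equivalence.
Qed.

Lemma edge_same_support L u v :
    u \in verts L -> v \in verts L -> [set u; v] \in edges L ->
  v \in pblock (supports L) u.
Proof.
move=> Lu Lv uv; rewrite pblock_equivalence_partition //; first exact: connect1.
by move=> x y z _ _ _; apply: connect_edge_equivalence.
Qed.

(** * The graph of a permutation *)

Definition perm_graph s : pregraph n := (moved s, perm_edges s).

Lemma connect_perm_graph s x y :
  x \in moved s -> connect (edge_rel (perm_graph s)) x y = (y \in porbit s x).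
Proof.
move=> mx; apply/idP/idP=> [xy|/porbitP[i ->]].
  (* An orbit is closed under the edge relation, since both ends of an edge lie in one orbit. *)
  rewrite -(closed_connect _ xy) ?porbit_id //.
  apply: intro_closed => [|u v]; first exact: connect_edge_sym.
  rewrite /edge_rel /= mem_perm_edges -!eq_porbit_mem => /andP[_ /orP[]/eqP->];
    by rewrite porbit_perm1.
elim: i => [|i IHi]; first by rewrite expg0 perm1.
apply: connect_trans IHi (connect1 _); rewrite /edge_rel /= expgSr permM.
by rewrite perm_edges_succ // (porbit_moved (mem_porbit s i x)).
Qed.

Lemma supports_perm_graph s : supports (perm_graph s) = cycle_supports s.
Proof.
apply: eq_in_imset => x mx; apply/setP=> y.
rewrite inE connect_perm_graph //; apply/andP/idP=> [[]//|yx].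
by rewrite /verts /= (porbit_moved yx).
Qed.

Lemma edges_component_perm s A : A \in cycle_supports s ->
  edges (component_on (perm_graph s) A) = [set [set x; s x] | x in A].
Proof.
move=> cA; apply/setP=> e; rewrite inE;
  apply/andP/imsetP=> [[/imsetP[x mx ->]]|[x Ax ->]].
  by rewrite subUset !sub1set => /andP[Ax _]; exists x.
rewrite subUset !sub1set (cycle_supports_succ _ cA) Ax perm_edges_succ //.
exact: cycle_supports_moved Ax.
Qed.

Lemma is_cycle_card C : is_cycle C -> (2 < #|verts C|)%N.
Proof. by case/existsP=> t /and4P[]; rewrite size_tuple. Qed.

Lemma is_K2_card C : is_K2 C -> #|verts C| = 2.
Proof. by case/existsP=> u /existsP[v /andP[uv /eqP->]]; rewrite cards2 uv. Qed.

Lemma mem_orbit_porbit (T : finType) (s : {perm T}) x :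
  fingraph.orbit s x =i porbit s x.
Proof.
move=> y; rewrite -fconnect_orbit; apply/idP/porbitP=> [xy|[i ->]].
  by exists (findex s x y); rewrite permX iter_findex.
by rewrite permX fconnect_iter.
Qed.

Lemma component_perm_is_cycle s A : A \in cycle_supports s ->
  is_cycle (component_on (perm_graph s) A) = (2 < #|A|)%N.
Proof.
move=> cA; apply/idP/idP=> [/is_cycle_card//|gt2].
(* Listing the orbit as [x], [s x], [s (s x)], and so on gives a traversal on which [next] is
   [s]. *)
have [x _ defA] := imsetP cA; pose p := fingraph.orbit s x.
have Ap : p =i A by move=> y; rewrite mem_orbit_porbit defA.
have Up : uniq p := orbit_uniq s x.
have szp : size p == #|A| by rewrite -(card_uniqP Up) (eq_card Ap).
apply/existsP; exists (Tuple szp).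
rewrite /traverses (edges_component_perm cA) /= (eqP szp) gt2 Up /=;
  apply/andP; split.
  by apply/eqP/setP=> y; rewrite inE Ap.
apply/eqP/setP=> e; apply/imsetP/imsetP=> -[y py ->]; exists y;
  rewrite ?Ap // -?Ap //.
  by rewrite (nextE (cycle_orbit (@perm_inj _ s) x)) ?Ap.
by rewrite (nextE (cycle_orbit (@perm_inj _ s) x)).
Qed.

Lemma cycle_supports_K2 s A x : A \in cycle_supports s -> #|A| = 2 -> x \in A ->
  A = [set x; s x] /\ s (s x) = x.
Proof.
move=> cA cA2 Ax; have defA := cycle_supports_porbit cA Ax.
have ssx : s (s x) = x by have := iter_porbit s x; rewrite defA cA2.
split=> //; apply/esym/eqP; rewrite eqEcard cA2 cards2.
have := cycle_supports_moved cA Ax; rewrite inE eq_sym => ->.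
by rewrite subUset !sub1set cycle_supports_succ // Ax.
Qed.

Lemma component_perm_K2 s A x : A \in cycle_supports s -> #|A| = 2 -> x \in A ->
  component_on (perm_graph s) A = K2 x (s x).
Proof.
move=> cA cA2 Ax; have [defA ssx] := cycle_supports_K2 cA cA2 Ax.
rewrite -[LHS]/(A, edges (component_on (perm_graph s) A))
  edges_component_perm //.
by rewrite {1 2}defA imsetU1 imset_set1 ssx [[set s x; x]]setUC setUid.
Qed.

Lemma mem_components_K2 s u v : u != v ->
  (K2 u v \in components (perm_graph s)) = ([set u; v] \in cycle_supports s).
Proof.
move=> uv; apply/idP/idP=> [/imsetP[A + [->]]|cA];
  first by rewrite -supports_perm_graph.
have cA2 : #|[set u; v]| = 2 by rewrite cards2 uv.
have [defA _] := cycle_supports_K2 cA cA2 (set21 u v).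
have su : s u = v.
  by case/set2_inj: defA => [[_ <-]|[_ Dv]] //; rewrite Dv eqxx in uv.
by rewrite -su -(component_perm_K2 cA cA2 (set21 u v)) mem_components
  supports_perm_graph.
Qed.

(** Components are the nontrivial orbits: those of size 2 give a [K2], the larger ones a cycle. *)
Lemma elementary_perm_graph e s :
  {in moved s, forall x, e x (s x)} -> elementary e (perm_graph s).
Proof.
move=> adj_s; apply/andP; split.
  apply/forall_inP=> _ /imsetP[x mx ->].
  rewrite subUset !sub1set /verts /= mem_movedE mx.
  by apply/existsP; exists x; apply/existsP; exists (s x); rewrite adj_s /=.
apply/forall_inP=> _ /imsetP[A + ->].
rewrite -/(supports (perm_graph s)) supports_perm_graph => cA.
have := cycle_supports_card cA; rewrite leq_eqVlt => /orP[/eqP cA2|gt2].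
  have [x mx defA] := imsetP cA; have Ax : x \in A by rewrite defA porbit_id.
  rewrite -/(component_on _ A) (component_perm_K2 cA (esym cA2) Ax).
  apply/orP; left; apply/existsP; exists x; apply/existsP; exists (s x).
  by rewrite eqxx andbT eq_sym; rewrite inE in mx.
by rewrite -/(component_on _ A) component_perm_is_cycle // gt2 orbT.
Qed.

Lemma subgraph_perm_graph e s : symmetric e ->
  is_subgraph e (perm_graph s) -> {in moved s, forall x, e x (s x)}.
Proof.
move=> sym_e /forall_inP sub x mx.
have /andP[_ /existsP[u /existsP[v /andP[uv /eqP]]]] :=
  sub _ (perm_edges_succ mx).
by case/set2_inj=> -[-> ->] //; rewrite sym_e.
Qed.

(* On a K_2 either enumeration of the two ends is a traversal, so [next] makes
   sense uniformly on both kinds of components. *)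
Definition tour C : seq 'I_n :=
  if [pick t : #|verts C|.-tuple 'I_n | traverses t C] is Some t then t
  else enum (verts C).

Lemma tour_uniq C : uniq (tour C).
Proof.
by rewrite /tour; case: pickP => [t /and4P[]//|_]; apply: enum_uniq.
Qed.

Lemma mem_tour C : tour C =i verts C.
Proof.
move=> x; rewrite /tour; case: pickP => [t /and4P[_ _ /eqP/setP/(_ x) + _]|_].
  by rewrite inE.
by rewrite mem_enum.
Qed.

Lemma size_tour C : size (tour C) = #|verts C|.
Proof. by rewrite -(card_uniqP (tour_uniq C)); apply: eq_card (mem_tour C). Qed.

Lemma tour_traverses C : is_cycle C -> traverses (tour C) C.
Proof.
case/existsP=> t Ct; rewrite /tour; case: pickP => [//|/(_ t)].
by rewrite Ct.
Qed.

Lemma tour_card C : is_K2 C || is_cycle C -> (1 < size (tour C))%N.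
Proof. by rewrite size_tour => /orP[/is_K2_card->//|/is_cycle_card/ltnW]. Qed.

(** For a cycle this is what a traversal means. On a [K2] the successor of an end differs from it,
    so it is the other end. *)
Lemma edges_tour C : is_K2 C || is_cycle C ->
  edges C = [set [set x; next (tour C) x] | x in verts C].
Proof.
move=> KC; case/orP: (KC) => [/existsP[u /existsP[v /andP[uv /eqP DC]]] | cC];
  last first.
  case/and4P: (tour_traverses cC) => _ _ _ /eqP {1}->.
  apply/setP=> a; apply/imsetP/imsetP=> -[x Cx ->]; exists x => //.
    by rewrite -mem_tour.
  by rewrite mem_tour.
have vC : verts C = [set u; v] by rewrite DC.
have nextV x : x \in verts C -> [set x; next (tour C) x] = [set u; v].
  move=> Cx; apply/eqP; rewrite eqEcard !cards2 uv eq_sym.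
  rewrite next_neq ?tour_uniq ?tour_card ?mem_tour //= andbT.
  by rewrite subUset !sub1set -vC Cx -mem_tour mem_next mem_tour.
rewrite (eq_in_imset nextV) [edges C](congr1 (@edges n) DC) /=.
apply/setP=> a; rewrite inE; apply/eqP/imsetP=> [->|[]//].
by exists u; rewrite // vC set21.
Qed.

(** * A permutation tracing a given elementary subgraph *)

Section TourPerm.

Variables (e : rel 'I_n) (L : pregraph n).
Hypothesis elL : elementary e L.

Definition tour_succ x :=
  next (tour (component_on L (pblock (supports L) x))) x.

Lemma tour_succE A x : A \in supports L -> x \in A ->
  tour_succ x = next (tour (component_on L A)) x.
Proof.
move=> LA Ax; rewrite /tour_succ (def_pblock _ LA Ax) //.
by case/and3P: (partition_supports L).
Qed.

Lemma tour_succ_out x : x \notin verts L -> tour_succ x = x.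
Proof.
move=> Lx; rewrite /tour_succ next_nth mem_tour ifN // /verts /=.
apply: contra Lx; rewrite mem_pblock.
by case/and3P: (partition_supports L) => /eqP->.
Qed.

Lemma pblock_tour_succ x :
  pblock (supports L) (tour_succ x) = pblock (supports L) x.
Proof.
have [Lx|Lx] := boolP (x \in verts L); last by rewrite tour_succ_out.
have [/eqP covL trivL _] := and3P (partition_supports L).
have Ax : x \in pblock (supports L) x by rewrite mem_pblock covL.
have LA : pblock (supports L) x \in supports L by rewrite pblock_mem ?covL.
apply: def_pblock => //.
by rewrite (tour_succE LA Ax) -(mem_tour (component_on L _)) mem_next mem_tour.
Qed.

Lemma tour_succ_inj : injective tour_succ.
Proof.
move=> x y eqxy; have := pblock_tour_succ x;
  rewrite eqxy pblock_tour_succ => eqA.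
move: eqxy; rewrite /tour_succ eqA.
exact: can_inj (prev_next (tour_uniq _)) _ _.
Qed.

(** Following the tours of all components at once gives a permutation with graph [L]. The second
    clause ties it to the traversals picked in [cycle_weight], so that its products of gains can be
    compared with closed walk gains. *)
Lemma tour_perm_ex : exists2 s : {perm 'I_n}, perm_graph s = L &
  forall A, A \in supports L ->
    {in A, forall x, s x = next (tour (component_on L A)) x}.
Proof.
exists (perm tour_succ_inj) => [|A LA x Ax];
  last by rewrite permE (tour_succE LA).
have [/eqP covL trivL _] := and3P (partition_supports L).
have [/forall_inP subL /forall_inP elemL] := andP elL.
have blockP x : x \in verts L ->
    exists2 A, A \in supports L & x \in A.
  by rewrite -covL => /bigcupP.
have KC A : A \in supports L ->
  is_K2 (component_on L A) || is_cycle (component_on L A).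
  by move=> LA; apply: elemL; rewrite mem_components.
have movedL : moved (perm tour_succ_inj) = verts L.
  apply/setP=> x; rewrite inE permE.
  have [Lx|Lx] := boolP (x \in verts L); last by rewrite tour_succ_out ?eqxx.
  have [A LA Ax] := blockP x Lx; rewrite (tour_succE LA Ax).
  by rewrite next_neq ?tour_uniq ?tour_card ?mem_tour // KC.
have succ_edges x A : A \in supports L -> x \in A ->
    [set x; tour_succ x] \in edges (component_on L A).
  move=> LA Ax; rewrite (edges_tour (KC A LA)) (tour_succE LA Ax).
  exact: imset_f.
rewrite /perm_graph movedL [RHS]surjective_pairing; congr pair.
apply/setP=> a; apply/imsetP/idP=> [[x]|La].
  rewrite movedL => Lx ->; have [A LA Ax] := blockP x Lx.
  by rewrite permE; have := succ_edges x A LA Ax; rewrite inE => /andP[].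
have /andP[sub_a /existsP[u /existsP[v /andP[_ /eqP Da]]]] := subL a La.
have /andP[Lu Lv] : (u \in verts L) && (v \in verts L).
  by move: sub_a; rewrite Da subUset !sub1set.
(* Both ends of an edge lie in one component, whose edges are the steps of its tour. *)
have [A LA Au] := blockP u Lu.
have Av : v \in A.
  by rewrite -(def_pblock trivL LA Au) edge_same_support // -Da.
have : a \in edges (component_on L A) by rewrite inE La Da subUset !sub1set Au.
rewrite (edges_tour (KC A LA)) => /imsetP[x Ax ->].
exists x; last by rewrite permE (tour_succE LA Ax).
by rewrite movedL -covL; apply/bigcupP; exists A.
Qed.

End TourPerm.

End ElementarySubgraphs.

(** * The sum over the permutations with a common graph *)

Lemma sum_same_edges (T : finType) (R : comPzSemiRingType) (w : T -> T -> R)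
    (s : {perm T}) :
  \sum_(t : {perm T} | (moved t == moved s) && (perm_edges t == perm_edges s))
      \prod_(x in moved t) w x (t x) =
    (\prod_(A in cycle_supports s | #|A| == 2%N) \prod_(x in A) w x (s x)) *
    \prod_(A in long_supports s)
      (\prod_(x in A) w x (s^-1%g x) + \prod_(x in A) w x (s x)).
Proof.
(* Expanding the right-hand product gives a sum over the sets [J] of reversed long cycles, matched
   with the permutations [t] through [flip s J]. *)
rewrite prodrD_subsets big_distrr /= (reindex_onto (flip s) (flipped s)) /=;
  last first.
  by move=> t /andP[/eqP eqM /eqP eqE]; rewrite flip_flipped.
apply: eq_big => [J | J /andP[_ ]].
  by rewrite moved_flip perm_edges_flip !eqxx flipped_flip.
rewrite flipped_flip => /subsetP sJ.
rewrite moved_flip (set_partition_big _ (partition_cycle_supports s)) /=.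
rewrite (bigID (fun A : {set T} => #|A| == 2%N)) /=; congr (_ * _).
  apply: eq_bigr => A /andP[cA /eqP cA2]; apply: eq_bigr => x Ax.
  rewrite flipE (cycle_supports_porbit cA Ax) ifN //.
  by apply/negP=> /sJ; rewrite inE cA2 andbF.
apply: eq_big => [A | A /andP[cA _]].
  rewrite inE; have [/cycle_supports_card cA|//] := boolP (A \in _).
  by rewrite [RHS]ltn_neqAle cA andbT eq_sym.
by case: ifP => JA; apply: eq_bigr => x Ax;
  rewrite flipE (cycle_supports_porbit cA Ax) JA.
Qed.

(** * Characteristic polynomial coefficients as sums over permutations *)

Lemma coef_char_poly_perm (R : comNzRingType) (n : nat) (A : 'M[R]_n)
    (i : nat) :
    (forall x, A x x = 0) -> (i <= n)%N ->
  (char_poly A)`_(n - i) =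
    \sum_(s : 'S_n | #|moved s| == i)
      (-1) ^+ #|cycle_supports s| * \prod_(x in moved s) A x (s x).
Proof.
move=> A0 le_in; rewrite /char_poly /determinant coef_sum [RHS]big_mkcond.
apply: eq_bigr => s _.
(* A fixed point contributes ['X] because the diagonal is zero, and a moved point contributes minus
   an entry, so each permutation yields a single monomial. *)
have -> : \prod_x char_poly_mx A x (s x) =
    'X^(n - #|moved s|) *
      ((-1) ^+ #|moved s| * \prod_(x in moved s) A x (s x))%:P.
  rewrite (bigID [in moved s]) /= mulrC; congr (_ * _).
    rewrite (eq_bigr (fun=> 'X)) => [|x mx]; last first.
      by rewrite !mxE movedP // eqxx A0 subr0.
    have /(canRL (addKn _)) <- : (#|moved s| + #|~: moved s| = n)%N.
      by rewrite cardsC card_ord.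
    rewrite prodr_const.
    by apply: (congr1 (fun k => 'X^k)); apply: eq_card => x; rewrite [RHS]inE.
  rewrite rmorphM rmorph_prod rmorphXn rmorphN1 -prodrN; apply: eq_bigr => x.
  by rewrite inE !mxE eq_sym => /negPf->; rewrite sub0r.
have -> : (-1) ^+ s = ((-1) ^+ s)%:P :> {poly R} by rewrite rmorphXn rmorphN1.
rewrite mulrCA -polyCM mulrA sign_moved coefMC coefXn.
have le_sn : (#|moved s| <= n)%N by rewrite -[leqRHS]card_ord max_card.
(* Truncated subtraction from [n] can be cancelled, as both subtrahends are at most [n]. *)
rewrite eqn_sub2lE // eq_sym.
by case: eqP; rewrite ?mul1r ?mul0r.
Qed.

(** * Weights of elementary subgraphs as sums over permutations *)

Section Weights.

Variables (F : fieldType) (f : F -> F) (n : nat) (Phi : skew_gain_graph f n).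
Implicit Types (s : {perm 'I_n}) (L C : pregraph n) (A : {set 'I_n}).

Lemma anti_involution_prod (I : eqType) (r : seq I) (c : I -> F) :
    anti_involution f -> {in r, forall i, c i \is a GRing.unit} ->
  f (\prod_(i <- r) c i) = \prod_(i <- r) f (c i).
Proof.
case=> fU _ fM cU.
have f1 : f 1 = 1.
  (* Cancel the unit [f 1] in the equation [f 1 * f 1 = f 1]. *)
  by apply: (mulrI (fU 1 (unitr1 _))); rewrite -fM ?unitr1 // !mulr1.
suff [_ ->//] : (\prod_(i <- r) c i \is a GRing.unit) /\
    f (\prod_(i <- r) c i) = \prod_(i <- r) f (c i).
elim: r cU => [|i r IHr] cU; first by rewrite !big_nil unitr1.
have [|Ur fr] := IHr; first by move=> j rj; rewrite cU // inE rj orbT.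
have Ui : c i \is a GRing.unit by rewrite cU ?mem_head.
by rewrite !big_cons unitrM Ui Ur fM // fr mulrC.
Qed.

Lemma cycle_weight_tour C : is_cycle C ->
  cycle_weight Phi C =
    closed_walk_gain Phi (tour C) + f (closed_walk_gain Phi (tour C)).
Proof.
case/existsP=> t Ct; rewrite /cycle_weight /tour; case: pickP => [//|/(_ t)].
by rewrite Ct.
Qed.

(** The sum over permutations with this graph factors over orbits. A 2-cycle gives the gains of both
    orientations of an edge, that is [norm_map]; a long cycle gives its two traversals, whose gains
    are exchanged by [f]. *)
Lemma elementary_weight_perm_graph s :
    anti_involution f -> {in moved s, forall x, adj Phi x (s x)} ->
    (forall A, A \in cycle_supports s ->
       {in A, forall x, s x = next (tour (component_on (perm_graph s) A)) x}) ->
  elementary_weight Phi (perm_graph s) =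
    (-1) ^+ #|cycle_supports s| *
    \sum_(t | perm_graph t == perm_graph s)
      \prod_(x in moved t) gain Phi x (t x).
Proof.
move=> f_anti adj_s tour_s; rewrite (sum_same_edges (gain Phi)).
rewrite /elementary_weight -mulrA.
rewrite -supports_perm_graph -card_components; congr (_ * (_ * _)).
  (* The product over increasing pairs is regrouped by the two-point orbit each pair spans, and each
     orbit receives exactly one pair. *)
  rewrite (partition_big (fun p => [set p.1; p.2])
    [pred A in cycle_supports s | #|A| == 2%N]) /=; last first.
    case=> u v /= /andP[lt_uv];
      have uv : u != v by apply: contraTneq lt_uv => ->; rewrite ltnn.
    by rewrite mem_components_K2 // => ->; rewrite cards2 uv.
  rewrite supports_perm_graph; apply: eq_bigr => A /andP[cA /eqP cA2].
  have [x Ax lt_x] : exists2 x, x \in A & (x < s x)%N.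
    have [y _ Dy] := imsetP cA; have Ay : y \in A by rewrite Dy porbit_id.
    have [_ ssy] := cycle_supports_K2 cA cA2 Ay.
    have := cycle_supports_moved cA Ay;
      rewrite inE -val_eqE neq_ltn => /orP[] lt_y.
      by exists (s y); rewrite ?ssy ?cycle_supports_succ.
    by exists y.
  have [defA ssx] := cycle_supports_K2 cA cA2 Ax.
  have neq_x : x != s x by rewrite -val_eqE neq_ltn lt_x.
  have adj_x : adj Phi x (s x) := adj_s _ (cycle_supports_moved cA Ax).
  rewrite (big_pred1 (x, s x)) => [|[u v]] /=.
    rewrite {1}defA big_setU1 ?inE //= big_set1 ssx /norm_map.
    by rewrite (gain_rev adj_x).
  apply/andP/eqP=> [[/andP[lt_uv _] /eqP]|[-> ->]].
    rewrite defA; case/set2_inj=> -[Du Dv]; rewrite Du Dv // in lt_uv *.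
    by rewrite ltnNge ltnW in lt_uv.
  by rewrite lt_x mem_components_K2 // -defA cA eqxx.
(* A component is determined by its vertex set, so the product over cycle components becomes one
   over long orbits. *)
rewrite big_mkcondr big_imset /=; last by move=> A B _ _ [].
rewrite -/(supports _) supports_perm_graph -big_mkcondr.
apply: eq_big => [A | A /andP[cA]].
  rewrite inE -/(component_on (perm_graph s) A).
  by have [/component_perm_is_cycle->|] := boolP (A \in _).
rewrite -/(component_on (perm_graph s) A) => cycA; set C := component_on _ _.
rewrite cycle_weight_tour // addrC /closed_walk_gain anti_involution_prod //;
  last first.
  move=> x; rewrite mem_tour => Ax; rewrite -(tour_s A) //.
  exact: gain_unit (adj_s _ (cycle_supports_moved cA Ax)).
rewrite !big_uniq ?tour_uniq //=; congr (_ + _); last first.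
  by apply: eq_big => [x | x]; rewrite mem_tour // => Ax; rewrite -(tour_s A).
(* Shifting by [s] turns the backward step from [x] to its predecessor into the step from [s x] to
   [x], whose gain is [f] of the forward gain. *)
rewrite [RHS](reindex_inj (@perm_inj _ s)) /=.
apply: eq_big => [x | x]; rewrite mem_tour ?cycle_supports_succ // => Ax.
rewrite permK -(tour_s A) // (gain_rev (adj_s _ _)) //.
exact: cycle_supports_moved Ax.
Qed.

End Weights.

Theorem theorem2p1 (F : fieldType) (charF0 : [pchar F] =i pred0)
    (f : F -> F) (f_anti : anti_involution f)
    (n : nat) (Phi : skew_gain_graph f n) (i : nat) (le_in : (i <= n)%N) :
  (char_poly (adjacency_matrix Phi))`_(n - i) =
    \sum_(L in elementary_subgraphs (adj Phi) i) elementary_weight Phi L.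
Proof.
rewrite coef_char_poly_perm // => [|x]; last by rewrite mxE adj_irr.
pose adj_perm (s : 'S_n) := [forall x in moved s, adj Phi x (s x)].
(* A permutation with a step along a non-edge picks a zero matrix entry and drops out. *)
rewrite (bigID adj_perm) /= [X in _ + X]big1 ?addr0; last first.
  move=> s /andP[_ /forall_inPn[x mx /negPf nadj]].
  by rewrite (bigD1 x) //= mxE nadj mul0r mulr0.
rewrite (partition_big (@perm_graph n) [in elementary_subgraphs (adj Phi) i])/=.
  apply: eq_bigr => L; rewrite inE => /andP[elL /eqP cardL].
  have [s DL tour_s] := tour_perm_ex elL.
  have [subL _] := andP elL.
  rewrite -{1}DL in subL; have adj_s := subgraph_perm_graph (adj_sym Phi) subL.
  rewrite -DL supports_perm_graph in tour_s.
  rewrite -{2}DL elementary_weight_perm_graph // big_distrr /=.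
  apply: eq_big => [t | t /andP[/andP[_ /forall_inP adj_t] /eqP Dt]].
    (* Having graph [L] already forces [t] to move exactly [i] points and to step along edges of the
       underlying graph only. *)
    rewrite DL andb_idl // => /eqP Dt; rewrite -cardL -Dt eqxx /=.
    by apply/forall_inP/(subgraph_perm_graph (adj_sym Phi)); rewrite Dt -DL.
  congr ((-1) ^+ _ * _); first by rewrite -!supports_perm_graph Dt DL.
  by apply: eq_bigr => x mx; rewrite mxE adj_t.
move=> s /andP[/eqP card_s /forall_inP adj_s].
by rewrite inE elementary_perm_graph //= card_s.
Qed.
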